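(* For every graph $H$ with $\chi(H)\le 4$, $$c_f(H)=\max\left\{\frac{\mathsf{v}(H)}{2},\tau(H)\right\}.$$
   Context: All graphs are finite and simple; $\mathsf{d}(G)=\mathsf{e}(G)/\mathsf{v}(G)$; $\tau(H)$ is the minimum size of a vertex cover of $H$. A jumbled model of $H$ in $G$ is a map $\mu$ from $V(H)$ to subsets of $V(G)$ such that each $G[\mu(v)]$ is connected (and nonempty) and for every edge $uv\in E(H)$ some edge of $G$ joins $\mu(u)$ and $\mu(v)$ (overlaps allowed). For $x\in V(G)$, $\mu^{\#}(x)=|\{v\in V(H):x\in\mu(v)\}|$. $\mathrm{Vol}_H(G)$ is the supremum of $\sum_i\alpha_i$ over finitely many reals $\alpha_i\ge0$ and jumbled models $\mu_i$ of $H$ in $G$ with $\sum_i\alpha_i\mu_i^{\#}(x)\le1$ for all $x\in V(G)$. The fractional extremal function is $c_f(H)=\sup_G\mathsf{d}(G)/\mathrm{Vol}_H(G)$ over non-null graphs $G$. *)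

(* Defs.v *)
From mathcomp Require Import all_boot all_order all_algebra.
From mathcomp Require Import all_classical all_reals all_analysis.

Set Implicit Arguments.
Unset Strict Implicit.
Unset Printing Implicit Defensive.

Import Order.TTheory GRing.Theory Num.Theory.

Record sgraph := SGraph {
  vertex :> finType;
  adj : rel vertex;
  adj_sym : symmetric adj;
  adj_irrefl : irreflexive adj }.

Arguments adj {s} : rename.

Section Graphs.
Variable G : sgraph.
Implicit Types (S : {set G}) (k : nat).

Definition edges : {set {set G}} :=
  [set [set p.1; p.2] | p : G * G & adj p.1 p.2]%SET.

Definition connected_graph : bool :=
  (0 < #|G|) && [forall x : G, forall y : G, connect adj x y].

Definition induced_adj S : rel {x : G | x \in S} :=
  fun x y => adj (val x) (val y).

Lemma induced_adj_sym S : symmetric (@induced_adj S).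
Proof. by move=> x y; apply: adj_sym. Qed.

Lemma induced_adj_irrefl S : irreflexive (@induced_adj S).
Proof. by move=> x; apply: adj_irrefl. Qed.

Definition induced_subgraph S : sgraph :=
  SGraph (@induced_adj_sym S) (@induced_adj_irrefl S).

Definition vertex_cover S : bool :=
  [forall x : G, forall y : G, adj x y ==> (x \in S) || (y \in S)].

Definition tau : nat :=
  #|[arg min_(S < [set: G]%SET | vertex_cover S) #|S| ]|.

Definition proper_coloring k (f : {ffun G -> 'I_k}) : bool :=
  [forall x : G, forall y : G, adj x y ==> (f x != f y)].

Definition colorable k : bool :=
  [exists f : {ffun G -> 'I_k}, proper_coloring f].

Lemma colorable_exists : exists k, colorable k.
Proof.
exists #|G|; apply/existsP; exists [ffun x => enum_rank x].
apply/forallP => x; apply/forallP => y; apply/implyP => xy.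
rewrite !ffunE (inj_eq enum_rank_inj).
by apply: contraL xy => /eqP->; rewrite adj_irrefl.
Qed.

Definition chi : nat := ex_minn colorable_exists.

End Graphs.

Local Open Scope ring_scope.

Definition density (R : realType) (G : sgraph) : R :=
  #|edges G|%:R / #|G|%:R.

Definition jumbled_model (H G : sgraph) (mu : {ffun H -> {set G}}) : bool :=
  [forall v : H, connected_graph (induced_subgraph (mu v))] &&
  [forall u : H, forall v : H, adj u v ==>
    [exists x in mu u, exists y in mu v, adj x y]].

Definition mult (H G : sgraph) (mu : {ffun H -> {set G}}) (x : G) : nat :=
  #|[set v : H | x \in mu v]%SET|.

Definition fractional_packing (R : realType) (H G : sgraph) (n : nat)
    (alpha : 'I_n -> R) (mu : 'I_n -> {ffun H -> {set G}}) : Prop :=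
  [/\ forall i, 0 <= alpha i,
      forall i, jumbled_model (mu i) &
      forall x : G, \sum_(i < n) alpha i * (mult (mu i) x)%:R <= 1].

(* The value is [+oo] when [H] is null. *)
Definition Vol (R : realType) (H G : sgraph) : \bar R :=
  ereal_sup [set s : \bar R |
    exists (n : nat) (alpha : 'I_n -> R) (mu : 'I_n -> {ffun H -> {set G}}),
      fractional_packing alpha mu /\ s = (\sum_(i < n) alpha i)%:E]%classic.

(* Division in [\bar R] satisfies [r / +oo = 0] and [0 / 0 = 0 * +oo = 0].
   The latter occurs only when [G] is edgeless and [H] is not: as soon as [G]
   has an edge [xy], sending every vertex of [H] to [{x, y}] is a jumbled
   model, so the volume is positive. *)
Definition c_f (R : realType) (H : sgraph) : \bar R :=
  ereal_sup [set r : \bar R |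
    exists2 G : sgraph, (0 < #|G|)%N & r = ((density R G)%:E / Vol R H G)%E]%classic.

(* Main.v *)
Require Import Defs.
From mathcomp Require Import all_boot all_order all_algebra.
From mathcomp Require Import all_classical all_reals all_analysis.
From mathcomp Require Import ring lra.

(* Lower bounds: in a complete graph every model has total multiplicity at least
   v(H), and in a star the vertices of H whose image contains the centre cover H.

   Upper bound: by linear programming duality it suffices to show, for weights
   w >= 0 on V(G) under which every model costs at least s > 0, that
   s e(G) <= c v(G) w(V(G)), where c = max(v(H)/2, tau(H)). Put u = c w / s.
   Models supported on small cliques give
     edges:     2 u(x) + u(y) >= 1            (a minimum cover to {x,y}, the rest to x),
     triangles: 2 u(x) + 2 u(y) + u(z) >= 2   (colour classes to x, y, z, {x,y}),
     K4:        u(x) + u(y) + u(z) + u(t) >= 2,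
   the last two by averaging over shifts of the four colours. Motzkin-Straus
   symmetrization of  sum_{xy in E} p(x) p(y) - p(V) sum_x p(x) u(x)  reduces
   e(G) <= v(G) u(V(G)) to vertex masses p supported on a clique, where it is a
   quadratic inequality in the three smallest weights and a lower bound for the
   others. *)

Set Implicit Arguments.
Unset Strict Implicit.
Unset Printing Implicit Defensive.

Import Order.TTheory GRing.Theory Num.Theory.
Local Open Scope ring_scope.

(** * A theorem of the alternative *)

(** Only strictly positive coefficients are allowed, so [0] is not in the cone for free; otherwise
    the second alternative below would hold trivially. *)
Inductive cone (R : realFieldType) (V : lmodType R) (L : seq V) : V -> Prop :=
| cone_in a : a \in L -> cone L a
| cone_add a b : cone L a -> cone L b -> cone L (a + b)
| cone_scale k a : 0 < k -> cone L a -> cone L (k *: a).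

Lemma cone_trans (R : realFieldType) (V : lmodType R) (L M : seq V) v :
  (forall a, a \in M -> cone L a) -> cone M v -> cone L v.
Proof.
move=> ML; elim=> [a /ML//|a b _ La _ Lb|k a k0 _ La].
- exact: cone_add.
- exact: cone_scale.
Qed.

Lemma cone_codom (R : realFieldType) (V : lmodType R) (J : finType)
    (F : J -> V) v : cone (codom F) v ->
  exists2 al : J -> R, (forall j, 0 <= al j) /\ 0 < \sum_j al j
    & v = \sum_j al j *: F j.
Proof.
elim=> [_ /codomP[j ->]|a b _ [al [al0 als] ->] _ [be [be0 bes] ->]
       |k a k0 _ [al [al0 als] ->]].
- exists (fun i => (i == j)%:R).
    by split=> [i|]; rewrite ?ler0n// (bigD1 j)//= eqxx big1 ?addr0// => i /negbTE->.
  rewrite (bigD1 j)//= eqxx scale1r big1 ?addr0// => i /negbTE->.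
  by rewrite scale0r.
- exists (fun j => al j + be j).
    split=> [j|]; first exact: addr_ge0.
    by rewrite big_split addr_gt0.
  by rewrite -big_split; apply: eq_bigr => j _; rewrite scalerDl.
- exists (fun j => k * al j).
    split=> [j|]; first by rewrite mulr_ge0// ltW.
    by rewrite -mulr_sumr mulr_gt0.
  by rewrite scaler_sumr; apply: eq_bigr => j _; rewrite scalerA.
Qed.

(** Supplies a value for an eliminated coordinate, strictly between its lower and its upper bounds;
    either list may be empty. *)
Lemma between_seqs (R : realFieldType) (X Y : seq R) :
  (forall x y, x \in X -> y \in Y -> x < y) ->
  exists z, (forall x, x \in X -> x < z) /\ (forall y, y \in Y -> z < y).
Proof.
elim: X => [|x X IH] XY.
  elim: Y {XY} => [|y Y [z [_ zY]]]; first by exists 0.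
  exists (Num.min z (y - 1)); split=> // y'; rewrite inE => /predU1P[->|/zY zy'].
    by rewrite gt_min ltrBlDr ltrDl ltr01 orbT.
  by rewrite gt_min zy'.
have [|z [Xz zY]] := IH; first by move=> a b aX; apply: XY; rewrite inE aX orbT.
have [xz|zx] := ltP x z.
  by exists z; split=> // a; rewrite inE => /predU1P[->|/Xz].
have {IH}[z' [xz' z'Y]] : exists z', x < z' /\ forall y, y \in Y -> z' < y.
  have: forall y, y \in Y -> x < y by move=> y; apply: XY; rewrite mem_head.
  elim: (Y) => [|y Y' IHY] xY; first by exists (x + 1); rewrite ltrDl ltr01.
  have [|z' [xz' z'Y]] := IHY; first by move=> b bY; apply: xY; rewrite inE bY orbT.
  have xy : x < y by apply: xY; rewrite mem_head.
  exists (Num.min z' ((x + y) / 2)); split.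
    by rewrite lt_min xz' /=; lra.
  move=> b; rewrite inE => /predU1P[->|/z'Y zb]; rewrite gt_min ?zb//.
  by apply/orP; right; lra.
exists z'; split=> // a; rewrite inE => /predU1P[->//|/Xz az].
by rewrite (lt_trans az) // (le_lt_trans zx).
Qed.

(* Ville's theorem of the alternative, by Fourier-Motzkin elimination of the
   coordinates in [s]. *)
Lemma ville_alternative (R : realFieldType) (T : finType) (s : seq T)
    (L : seq {ffun T -> R^o}) : uniq s ->
  (exists2 w : T -> R, forall i, 0 <= w i
     & forall a : {ffun T -> R^o}, a \in L -> 0 < \sum_(i <- s) a i * w i) \/
  (exists2 v : {ffun T -> R^o}, cone L v & forall i, i \in s -> v i <= 0).
Proof.
elim: s L => [|i s IH] L /=.
  case: L => [|a L] _; first by left; exists (fun=> 0).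
  by right; exists a => //; apply: cone_in; rewrite mem_head.
case/andP=> is' us.
(* Elimination of coordinate [i]: [comb] cancels it between opposite signs, and keeping a constraint
   with [a i < 0] amounts to combining it with [w i >= 0]. *)
pose neg := [seq a : {ffun T -> R^o} <- L | a i <= 0].
pose comb (a b : {ffun T -> R^o}) := - b i *: a + a i *: b.
pose mix := [seq comb a b |
  a <- [seq a : {ffun T -> R^o} <- L | 0 < a i],
  b <- [seq b : {ffun T -> R^o} <- L | b i < 0]].
have [[w w0 Lw]|[v Lv v0]] := IH (neg ++ mix) us; last first.
  right; exists v.
    apply: cone_trans Lv => a; rewrite mem_cat => /orP[|].
      by rewrite mem_filter => /andP[_ aL]; apply: cone_in.
    case/allpairsP=> -[b c] /=; rewrite !mem_filter.
    case=> /andP[b0 bL] /andP[c0 cL] ->.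
    apply: cone_add; apply: cone_scale; rewrite ?oppr_gt0//; exact: cone_in.
  have vi : v i <= 0.
    elim: Lv {v0} => [a|a b _ a0 _ b0|k a k0 _ a0].
    + rewrite mem_cat => /orP[|]; first by rewrite mem_filter => /andP[].
      case/allpairsP=> -[b c] /= [_ _ ->]; rewrite !ffunE /GRing.scale/=.
      by rewrite mulNr mulrC addNr.
    + by rewrite ffunE; lra.
    + by rewrite ffunE /GRing.scale/= mulr_ge0_le0// ltW.
  by move=> j; rewrite inE => /predU1P[->|/v0].
pose S (a : {ffun T -> R^o}) := \sum_(j <- s) a j * w j.
have Sneg a : a \in L -> a i <= 0 -> 0 < S a.
  by move=> aL a0; apply: Lw; rewrite mem_cat mem_filter a0 aL.
have Smix a b : a \in L -> b \in L -> 0 < a i -> b i < 0 ->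
    0 < - b i * S a + a i * S b.
  move=> aL bL a0 b0.
  have /Lw : comb a b \in neg ++ mix.
    rewrite mem_cat; apply/orP; right; apply/allpairsP; exists (a, b) => /=.
    by rewrite !mem_filter a0 b0 aL bL.
  rewrite /S 2!mulr_sumr -big_split/=; congr (_ < _); apply: eq_bigr => j _.
  by rewrite !ffunE /GRing.scale/= mulrDl !mulrA.
(* The head [0] makes the new weight nonnegative; it lies below every upper bound because [neg]
   forces [0 < S b]. *)
have [|z [Xz zY]] := @between_seqs R
    (0 :: [seq - S a / a i | a : {ffun T -> R^o} <- L & 0 < a i])
    [seq - S b / b i | b : {ffun T -> R^o} <- L & b i < 0].
  move=> x y; rewrite inE => xX /mapP[b]; rewrite mem_filter => /andP[b0 bL] ->.
  rewrite ltr_ndivlMr//; case/predU1P: xX => [->|/mapP[a]].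
    by rewrite mul0r oppr_lt0 Sneg// ltW.
  rewrite mem_filter => /andP[a0 aL] ->.
  rewrite mulrAC ltr_pdivlMr//; have := Smix _ _ aL bL a0 b0; lra.
left; exists (fun j => if j == i then z else w j).
  by move=> j; case: eqP => // _; rewrite ltW// Xz ?mem_head.
move=> a aL; rewrite big_cons eqxx.
rewrite (_ : \sum_(j <- s) _ = S a); last first.
  rewrite /S big_seq [RHS]big_seq; apply: eq_bigr => j js.
  by case: eqP js is' => // -> ->.
have [a0|a0|a0] := ltgtP (a i) 0.
- have /zY : - S a / a i \in [seq - S b / b i | b : {ffun T -> R^o} <- L & b i < 0].
    by apply: map_f; rewrite mem_filter a0.
  by rewrite ltr_ndivlMr// mulrC; lra.
- have /Xz : - S a / a i \in 0 :: [seq - S a / a i | a : {ffun T -> R^o} <- L & 0 < a i].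
    rewrite inE; apply/orP; right.
    by apply: (map_f (fun a : {ffun T -> R^o} => - S a / a i)); rewrite mem_filter a0.
  by rewrite ltr_pdivrMr// mulrC; lra.
- by rewrite a0 mul0r add0r Sneg// a0.
Qed.

(** Ville's alternative for the vectors [A j - t]; the coefficients of a cone element have positive
    sum, hence can be normalised to total 1. *)
Lemma minimax (R : realFieldType) (I J : finType) (A : J -> I -> R) (t : R) :
  (exists al : J -> R, [/\ forall j, 0 <= al j, \sum_j al j = 1
     & forall i, \sum_j al j * A j i <= t]) \/
  (exists2 w : I -> R, forall i, 0 <= w i
     & forall j, t * \sum_i w i < \sum_i w i * A j i).
Proof.
pose F j : {ffun I -> R^o} := [ffun i => A j i - t].
have [[w w0 Fw]|[v /cone_codom[al [al0 als] ->] v0]] :=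
    ville_alternative (codom F) (enum_uniq I).
  right; exists w => // j; rewrite -subr_gt0.
  have := Fw _ (codom_f F j); congr (_ < _); rewrite big_enum /= mulr_sumr -sumrB.
  by apply: eq_bigr => i _; rewrite ffunE mulrBl mulrC.
left; exists (fun j => al j / \sum_j al j); split=> [j||i].
- by rewrite divr_ge0// ltW.
- by rewrite -mulr_suml divff// gt_eqF.
- under eq_bigr do rewrite mulrAC.
  rewrite -mulr_suml ler_pdivrMr// -subr_le0 mulr_sumr -sumrB.
  have := v0 i (mem_enum _ _); rewrite sum_ffunE; congr (_ <= _).
  by apply: eq_bigr => j _; rewrite !ffunE /GRing.scale/= mulrBr [t * _]mulrC.
Qed.

(** * Motzkin-Straus symmetrization *)

(** For masses on a clique: [p1], [p2], [p3] sit on the three lightest vertices, [r] is the mass of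
    all others, whose weights are at least [u4], and [L] bounds the weighted mass. Discarding the
    squares of the other masses only enlarges the left side. *)
Lemma clique_ineq (R : realFieldType) (u1 u2 u3 u4 p1 p2 p3 r L : R) :
  0 <= u1 -> u1 <= u2 -> u2 <= u3 -> u3 <= u4 ->
  1 <= 2 * u1 + u2 -> 2 <= 2 * u1 + 2 * u2 + u3 -> 2 <= u1 + u2 + u3 + u4 ->
  0 <= p1 -> 0 <= p2 -> 0 <= p3 -> 0 <= r ->
  p1 * u1 + p2 * u2 + p3 * u3 + r * u4 <= L ->
  (p1 + p2 + p3 + r) ^+ 2 - (p1 ^+ 2 + p2 ^+ 2 + p3 ^+ 2) <=
    2 * (p1 + p2 + p3 + r) * L.
Proof.
move=> u10 u12 u23 u34 e t k p10 p20 p30 r0 hL.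
set P := p1 + p2 + p3 + r; have P0 : 0 <= P by rewrite !addr_ge0.
have mono v1 v2 v3 v4 : v1 <= u1 -> v2 <= u2 -> v3 <= u3 -> v4 <= u4 ->
    P ^+ 2 - (p1 ^+ 2 + p2 ^+ 2 + p3 ^+ 2) <=
      2 * P * (p1 * v1 + p2 * v2 + p3 * v3 + r * v4) ->
    P ^+ 2 - (p1 ^+ 2 + p2 ^+ 2 + p3 ^+ 2) <= 2 * P * L.
  move=> h1 h2 h3 h4 /le_trans; apply; apply: ler_wpM2l; first by rewrite mulr_ge0.
  by apply: le_trans hL; rewrite !lerD// ler_wpM2l.
(* Up to 2/9 the edge bound [1 - 2 * u1] on the other weights suffices; from 1/5 on, the common
   value [(2 - u1) / 3] used below respects that bound. *)
have [u15|u15] := lerP u1 (1 / 5).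
  apply: (@mono u1 (1 - 2 * u1) (1 - 2 * u1) (1 - 2 * u1)); try lra.
  have -> : p1 * u1 + p2 * (1 - 2 * u1) + p3 * (1 - 2 * u1) + r * (1 - 2 * u1)
    = P * (1 - 2 * u1) - p1 * (1 - 3 * u1) by rewrite /P; ring.
  have -> : 2 * P * (P * (1 - 2 * u1) - p1 * (1 - 3 * u1)) =
    P ^+ 2 - p1 ^+ 2 + (p1 - P * (1 - 3 * u1)) ^+ 2
    + P ^+ 2 * (u1 * (2 - 9 * u1)) by ring.
  have := sqr_ge0 p2; have := sqr_ge0 p3.
  have := sqr_ge0 (p1 - P * (1 - 3 * u1)).
  have : 0 <= P ^+ 2 * (u1 * (2 - 9 * u1)).
    by rewrite mulr_ge0 ?sqr_ge0// mulr_ge0//; lra.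
  lra.
have [u12'|u12'] := lerP (1 / 2) u1.
  apply: (@mono (1/2) (1/2) (1/2) (1/2)); try lra.
  have := sqr_ge0 p1; have := sqr_ge0 p2; have := sqr_ge0 p3.
  by rewrite -!mulrDl -/P; lra.
(* Lower the weights until the last constraint is tight; the gaps [d1, d2, d3] to
   the fourth weight then lie in [0, 1/2], and the difference of the two sides is
   [sum (p_i - d_i P)^2 + P^2 sum d_i (1/2 - d_i)]. *)
have [v2 [v3 [v4 [h2 h3 h4 [e' t' k' [v12 v23 v34]]]]]] : exists v2 v3 v4,
    [/\ v2 <= u2, v3 <= u3, v4 <= u4 &
    [/\ 1 <= 2 * u1 + v2, 2 <= 2 * u1 + 2 * v2 + v3, u1 + v2 + v3 + v4 = 2 &
     [/\ u1 <= v2, v2 <= v3 & v3 <= v4]]].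
  (* Lower from the top: level the last three weights if [u2] allows it, otherwise the last two,
     otherwise only the fourth. *)
  have [a|a] := lerP ((2 - u1) / 3) u2.
    exists ((2 - u1) / 3), ((2 - u1) / 3), ((2 - u1) / 3).
    by do !split; lra.
  have [b|b] := lerP ((2 - u1 - u2) / 2) u3.
    exists u2, ((2 - u1 - u2) / 2), ((2 - u1 - u2) / 2).
    by do !split; lra.
  by exists u2, u3, (2 - u1 - u2 - u3); do !split; lra.
apply: (mono u1 v2 v3 v4) => //.
have -> : v4 = 2 - u1 - v2 - v3 by lra.
set d1 := 2 - 2 * u1 - v2 - v3; set d2 := 2 - u1 - 2 * v2 - v3.
set d3 := 2 - u1 - v2 - 2 * v3.
have q d : 0 <= d -> d <= 1 / 2 -> 0 <= P ^+ 2 * (d * (1 / 2 - d)).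
  by move=> *; rewrite mulr_ge0 ?sqr_ge0// mulr_ge0//; lra.
have := q d1; have := q d2; have := q d3.
have := sqr_ge0 (p1 - d1 * P); have := sqr_ge0 (p2 - d2 * P).
have := sqr_ge0 (p3 - d3 * P).
move=> s3 s2 s1 q3 q2 q1.
have {}q1 : 0 <= P ^+ 2 * (d1 * (1 / 2 - d1)) by apply: q1; rewrite /d1; lra.
have {}q2 : 0 <= P ^+ 2 * (d2 * (1 / 2 - d2)) by apply: q2; rewrite /d2; lra.
have {}q3 : 0 <= P ^+ 2 * (d3 * (1 / 2 - d3)) by apply: q3; rewrite /d3; lra.
rewrite -subr_ge0.
have -> : 2 * P * (p1 * u1 + p2 * v2 + p3 * v3 + r * (2 - u1 - v2 - v3)) -
    (P ^+ 2 - (p1 ^+ 2 + p2 ^+ 2 + p3 ^+ 2)) =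
   (p1 - d1 * P) ^+ 2 + (p2 - d2 * P) ^+ 2 + (p3 - d3 * P) ^+ 2 +
   (P ^+ 2 * (d1 * (1 / 2 - d1)) + P ^+ 2 * (d2 * (1 / 2 - d2)) +
    P ^+ 2 * (d3 * (1 / 2 - d3))).
  by rewrite /d1 /d2 /d3 /P; field.
by rewrite !addr_ge0.
Qed.

Lemma sum_delta2 (R : pzRingType) (I : finType) (x y : I) (F : I -> R) :
  \sum_z ((z == x)%:R - (z == y)%:R) * F z = F x - F y.
Proof.
have sum_delta v : \sum_z (z == v)%:R * F z = F v.
  by rewrite (bigD1 v)//= eqxx mul1r big1 ?addr0// => z /negbTE->; rewrite mul0r.
by under eq_bigr do rewrite mulrBl; rewrite sumrB !sum_delta.
Qed.

(** Each edge is the image of exactly two ordered pairs, distinct because [adj] is irreflexive. *)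
Lemma edges_double (G : sgraph) :
  (\sum_(x : G) \sum_(y : G) adj x y = 2 * #|edges G|)%N.
Proof.
rewrite pair_big /=.
rewrite -big_mkcond (eq_bigl (mem [set p : G * G | adj p.1 p.2]%SET));
  last by move=> p; rewrite /= inE.
rewrite (partition_big_imset (fun p : G * G => [set p.1; p.2]%SET)).
rewrite mulnC -sum_nat_const; apply: eq_bigr => e /imsetP[[a b]].
rewrite inE /= => ab ->.
have ab' : a != b by apply: contraL ab => /eqP->; rewrite adj_irrefl.
rewrite sum1_card (_ : 2 = #|[set (a, b); (b, a)]%SET|)%N; last first.
  by rewrite cards2 xpair_eqE negb_and ab'.
apply: eq_card => -[x y]; rewrite !inE /= {1}/in_mem /= inE !xpair_eqE /=.
apply/andP/orP => [[xy /eqP E]|].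
  have xy' : x != y by apply: contraL xy => /eqP->; rewrite adj_irrefl.
  have := set21 x y; have := set22 x y; rewrite E !inE.
  case/orP=> /eqP yE /orP[]/eqP xE; rewrite xE yE ?eqxx in xy' *; by [|left|right].
case=> /andP[/eqP-> /eqP->]; first by [].
by rewrite adj_sym ab; split=> //; rewrite finset.setUC.
Qed.

Section MotzkinStraus.
Variables (R : realFieldType) (G : sgraph) (u : G -> R).
Hypothesis u_ge0 : forall x, 0 <= u x.
Hypothesis u_edge : forall x y, adj x y -> u x <= u y -> 1 <= 2 * u x + u y.
Hypothesis u_triangle : forall x y z, adj x y -> adj x z -> adj y z ->
  2 <= 2 * u x + 2 * u y + u z.
Hypothesis u_K4 : forall x y z t, adj x y -> adj x z -> adj x t ->
  adj y z -> adj y t -> adj z t -> 2 <= u x + u y + u z + u t.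

(** Twice the functional to be symmetrized, since every edge is counted in both orders. *)
Let Q (p : G -> R) :=
  \sum_x \sum_y p x * p y * ((adj x y)%:R - 2 * u y).

Lemma QE p : Q p =
  \sum_x \sum_y (adj x y)%:R * p x * p y - 2 * (\sum_x p x) * \sum_x p x * u x.
Proof.
rewrite -mulrA mulr_suml mulr_sumr -sumrB; apply: eq_bigr => x _.
rewrite 2!mulr_sumr -sumrB; apply: eq_bigr => y _; ring.
Qed.

(** Sort the support by weight; the three lightest vertices and the pooled rest are the data of
    [clique_ineq]. *)
Lemma Q_clique (p : G -> R) : (forall x, 0 <= p x) ->
  (forall x y, p x != 0 -> p y != 0 -> x != y -> adj x y) -> Q p <= 0.
Proof.
move=> p0 clq; pose leu x y := u x <= u y.
pose s := sort leu (enum [pred x | p x != 0]).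
have sumE (F : G -> R) : (forall x, p x = 0 -> F x = 0) -> \sum_x F x = \sum_(x <- s) F x.
  move=> F0; have ps : perm_eq s (enum [pred x | p x != 0]) by rewrite perm_sort.
  rewrite [RHS](perm_big _ ps) big_enum /= [RHS]big_mkcond /=; apply: eq_bigr => x _.
  by case: ifP => // /negbFE/eqP/F0.
have us : uniq s by rewrite sort_uniq enum_uniq.
have ss : pairwise leu s.
  rewrite -sorted_pairwise; last by move=> y x z; apply: le_trans.
  by apply: sort_sorted => x y; apply: le_total.
have sp x : x \in s -> p x != 0 by rewrite mem_sort mem_enum.
have adjs x y : x \in s -> y \in s -> x != y -> adj x y.
  by move=> /sp xs /sp ys; apply: clq.
have -> : Q p = (\sum_(x <- s) p x) ^+ 2 - \sum_(x <- s) p x ^+ 2 -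
    2 * (\sum_(x <- s) p x) * \sum_(x <- s) p x * u x.
  rewrite QE -!sumE; try by move=> x -> //; rewrite ?expr0n ?mul0r.
  congr (_ - _); rewrite expr2 mulr_suml -sumrB; apply: eq_bigr => x _.
  rewrite mulr_sumr (bigD1 x)//= adj_irrefl !mul0r add0r [X in _ = X - _](bigD1 x)//=.
  rewrite expr2 addrC addrK; apply: eq_bigr => y yx.
  have [->|px] := eqVneq (p x) 0; first by rewrite !(mulr0, mul0r).
  have [->|py] := eqVneq (p y) 0; first by rewrite !(mulr0, mul0r).
  by rewrite clq ?mul1r// eq_sym.
rewrite subr_le0.
case: s us ss adjs {sumE sp} => [|a [|b [|c [|d s]]]].
- by rewrite !big_nil !(mulr0, expr0n) subr0.
- move=> _ _ _; rewrite !big_cons !big_nil !addr0.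
  have := u_ge0 a; have := p0 a.
  (* A missing vertex gets mass 0 and a fictitious weight large enough for every hypothesis. *)
  have := @clique_ineq R (u a) (u a + 2) (u a + 2) (u a + 2) (p a) 0 0 0 (p a * u a).
  by rewrite !(mul0r, addr0, expr0n) /= => + *; apply; lra.
- rewrite /= !inE !andbT => ab lab adjs; rewrite !big_cons !big_nil !addr0.
  have := u_ge0 a; have := p0 a; have := p0 b.
  have eab : adj a b by apply: adjs; rewrite // !inE eqxx ?orbT.
  have := u_edge eab lab; rewrite /leu in lab.
  have := @clique_ineq R (u a) (u b) (u b + 2) (u b + 2) (p a) (p b) 0 0
    (p a * u a + p b * u b).
  rewrite !(mul0r, addr0, expr0n) /=.
  by move=> + *; apply; lra.
- rewrite /= !inE !negb_or !andbT => /andP[/andP[ab ac] bc].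
  case/andP=> /andP[lab lac] lbc adjs; rewrite !big_cons !big_nil !addr0.
  have eab : adj a b by apply: adjs; rewrite // !inE eqxx ?orbT.
  have eac : adj a c by apply: adjs; rewrite // !inE eqxx ?orbT.
  have ebc : adj b c by apply: adjs; rewrite // !inE eqxx ?orbT.
  have := u_ge0 a; have := p0 a; have := p0 b; have := p0 c.
  have := u_edge eab lab; have := u_triangle eab eac ebc.
  rewrite /leu in lab lac lbc.
  have := @clique_ineq R (u a) (u b) (u c) (u c + 2) (p a) (p b) (p c) 0
    (p a * u a + p b * u b + p c * u c).
  rewrite !(mul0r, addr0, expr0n) /= !addrA.
  by move=> + *; apply; lra.
rewrite /= !inE !negb_or => /andP[/and4P[ab ac ad _] /andP[/and3P[bc bd _]]].
case/andP=> /andP[cd _] _.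
case/andP=> /and4P[lab lac lad _] /andP[/and3P[lbc lbd _]] /andP[/andP[lcd _]].
case/andP=> lds _ adjs; rewrite !big_cons.
have eab : adj a b by apply: adjs; rewrite // !inE eqxx ?orbT.
have eac : adj a c by apply: adjs; rewrite // !inE eqxx ?orbT.
have ead : adj a d by apply: adjs; rewrite // !inE eqxx ?orbT.
have ebc : adj b c by apply: adjs; rewrite // !inE eqxx ?orbT.
have ebd : adj b d by apply: adjs; rewrite // !inE eqxx ?orbT.
have ecd : adj c d by apply: adjs; rewrite // !inE eqxx ?orbT.
have r0 : 0 <= \sum_(j <- s) p j by apply: sumr_ge0.
have q0 : 0 <= \sum_(j <- s) p j ^+ 2 by apply: sumr_ge0 => j _; apply: sqr_ge0.
have rd : (\sum_(j <- s) p j) * u d <= \sum_(j <- s) p j * u j.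
  rewrite mulr_suml big_seq [leRHS]big_seq; apply: ler_sum => j js.
  by rewrite ler_wpM2l//; exact: (allP lds).
have := u_ge0 a; have := p0 a; have := p0 b; have := p0 c; have := p0 d.
have := u_edge eab lab; have := u_triangle eab eac ebc.
have := u_K4 eab eac ead ebc ebd ecd; have := sqr_ge0 (p d).
rewrite /leu in lab lac lbc lcd.
have := @clique_ineq R (u a) (u b) (u c) (u d) (p a) (p b) (p c)
  (p d + \sum_(j <- s) p j)
  (p a * u a + (p b * u b + (p c * u c + (p d * u d + \sum_(j <- s) p j * u j)))).
rewrite -!addrA => H *; apply: (le_trans _ (H _ _ _ _ _ _ _ _ _ _ _ _)); lra.
Qed.

(** An identity valid for every quadratic form: when [Q] vanishes at [a - b], it is affine on the
    line through [a] and [b]. *)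
Lemma Q_convex l a b : Q (fun x => l * a x + (1 - l) * b x) =
  l * Q a + (1 - l) * Q b - l * (1 - l) * Q (fun x => a x - b x).
Proof.
rewrite /Q !mulr_sumr -big_split -sumrB; apply: eq_bigr => x _ /=.
rewrite !mulr_sumr -big_split -sumrB; apply: eq_bigr => y _ /=; ring.
Qed.

(* Moving mass between nonadjacent vertices changes [Q] linearly. *)
Lemma Q_shift s x y : ~~ adj x y ->
  Q (fun z => s * ((z == x)%:R - (z == y)%:R)) = 0.
Proof.
move=> /negbTE xy; pose D z : R := (z == x)%:R - (z == y)%:R.
pose M z w : R := (adj z w)%:R - 2 * u w.
have -> : Q (fun z => s * D z) = s ^+ 2 * \sum_z D z * \sum_w D w * M z w.
  rewrite /Q mulr_sumr; apply: eq_bigr => z _; rewrite 2!mulr_sumr.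
  by apply: eq_bigr => w _; rewrite /M; ring.
under eq_bigr do rewrite sum_delta2; rewrite sum_delta2 /M.
by rewrite !adj_irrefl [adj y x]adj_sym xy; ring.
Qed.

(** Induction on the size of the support. If it contains nonadjacent [x] and [y], then [p] is a
    convex combination of [a] and [b], which move their joint mass to [x] or to [y]; [Q] is affine
    in between and both supports are smaller. *)
Lemma Q_le0 (p : G -> R) : (forall x, 0 <= p x) -> Q p <= 0.
Proof.
have [n] := ubnP #|[set x | p x != 0]%SET|.
elim: n p => // n IH p; rewrite ltnS => sn p0.
have [clq|] := pselect (forall x y, p x != 0 -> p y != 0 -> x != y -> adj x y).
  exact: Q_clique.
move=> /existsNP[x /existsNP[y]].
move=> /not_implyP[px /not_implyP[py /not_implyP[xy /negP nxy]]].
pose s := p x + p y; have s0 : 0 < s by rewrite addr_gt0 // lt_neqAle eq_sym p0 andbT.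
pose a z : R := if z == x then s else if z == y then 0 else p z.
pose b z : R := if z == y then s else if z == x then 0 else p z.
pose l := p x / s.
have -> : p = (fun z => l * a z + (1 - l) * b z).
  apply/funext => z; rewrite /a /b /l.
  have [->|zx] := eqVneq z x.
    by rewrite (negbTE xy) mulr0 addr0 divfK// gt_eqF.
  have [->|zy] := eqVneq z y.
    by rewrite mulr0 add0r mulrBl mul1r divfK ?gt_eqF// /s; ring.
  by ring.
rewrite Q_convex (_ : (fun z => a z - b z) = fun z => s * ((z == x)%:R - (z == y)%:R)).
  rewrite Q_shift// mulr0 subr0.
  have l0 : 0 <= l by rewrite divr_ge0// ltW.
  have l1 : 0 <= 1 - l by rewrite subr_ge0 ler_pdivrMr// mul1r lerDl.
  have small (q : G -> R) z : p z != 0 -> q z = 0 -> (forall t, p t = 0 -> q t = 0) ->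
      (#|[set t | q t != 0%R]%SET| < n)%N.
    move=> pz qz qp; apply: leq_trans sn; apply: proper_card; apply/properP; split.
      by apply/fintype.subsetP => t; rewrite !inE; apply: contra_neq => /qp.
    by exists z; rewrite !inE ?pz// qz eqxx.
  have nz t z : p z != 0 -> p t = 0 -> (t == z) = false.
    by move=> pz pt; apply: contraNF pz => /eqP <-; rewrite pt.
  have Qa : Q a <= 0.
    apply: IH => [|z]; last by rewrite /a; do 2?case: ifP => // _; exact: ltW.
    apply: (small a y) => //; first by rewrite /a eq_sym (negbTE xy) eqxx.
    by move=> t pt; rewrite /a !nz.
  have Qb : Q b <= 0.
    apply: IH => [|z]; last by rewrite /b; do 2?case: ifP => // _; exact: ltW.
    apply: (small b x) => //; first by rewrite /b (negbTE xy) eqxx.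
    by move=> t pt; rewrite /b !nz.
  by rewrite -oppr_ge0 opprD addr_ge0// -mulrN mulr_ge0// oppr_ge0.
apply/funext => z; rewrite /a /b.
have [->|zx] := eqVneq z x; first by rewrite (negbTE xy) /=; ring.
by case: (z == y) => /=; ring.
Qed.

(** Mass 1 at every vertex turns [Q p <= 0] into the claim, up to a factor 2. *)
Lemma edges_le_weight : #|edges G|%:R <= #|G|%:R * \sum_x u x.
Proof.
have := @Q_le0 (fun=> 1) (fun=> ler01); rewrite QE subr_le0.
rewrite sumr_const -mulr_natl mulr1.
rewrite [X in _ * X](eq_bigr u); last by move=> x _; rewrite mul1r.
rewrite (_ : \sum_x _ = 2 * #|edges G|%:R); last first.
  rewrite -natrM -edges_double natr_sum; apply: eq_bigr => x _.
  by rewrite natr_sum; apply: eq_bigr => y _; rewrite !mulr1.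
by rewrite -mulrA ler_pM2l.
Qed.

End MotzkinStraus.

(** * Models supported on cliques *)

Lemma connected_clique (G : sgraph) (S : {set G}) :
  S != finset.set0 -> (forall x y, x \in S -> y \in S -> x != y -> adj x y) ->
  connected_graph (induced_subgraph S).
Proof.
case/set0Pn => x xS clq; apply/andP; split.
  by apply/card_gt0P; exists (exist _ x xS).
apply/forallP => -[y yS]; apply/forallP => -[z zS].
have [yz|yz] := eqVneq y z.
  rewrite (_ : exist _ z zS = exist _ y yS) ?connect0//.
  exact/val_inj.
by apply: connect1; apply: clq.
Qed.

Lemma connected_set1 (G : sgraph) (x : G) :
  connected_graph (induced_subgraph [set x]%SET).
Proof.
apply: connected_clique => [|y z]; first by apply/set0Pn; exists x; rewrite set11.
by rewrite !inE => /eqP-> /eqP->; rewrite eqxx.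
Qed.

Lemma connected_edge (G : sgraph) (x y : G) : adj x y ->
  connected_graph (induced_subgraph [set x; y]%SET).
Proof.
move=> xy; apply: connected_clique => [|z t].
  by apply/set0Pn; exists x; rewrite set21.
rewrite !inE => /orP[]/eqP-> /orP[]/eqP-> //; rewrite ?eqxx//.
by rewrite adj_sym.
Qed.

(** Literally the edge condition of [jumbled_model]; the sets may overlap. *)
Definition touching (G : sgraph) (A B : {set G}) : bool :=
  [exists x in A, exists y in B, adj x y].

Lemma touchingP (G : sgraph) (A B : {set G}) x y :
  x \in A -> y \in B -> adj x y -> touching A B.
Proof.
move=> xA yB xy; apply/existsP; exists x; rewrite xA /=.
by apply/existsP; exists y; rewrite yB.
Qed.

Lemma touching_sym (G : sgraph) : symmetric (@touching G).
Proof.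
suff touchingC (A B : {set G}) : touching A B -> touching B A.
  by move=> A B; apply/idP/idP; apply: touchingC.
case/existsP => x /andP[xA /existsP[y /andP[yB xy]]].
by apply: (touchingP yB xA); rewrite adj_sym.
Qed.

Section Models.
Variables (R : realFieldType) (H G : sgraph) (w : G -> R).

Definition cost (mu : {ffun H -> {set G}}) : R := \sum_x w x * (mult mu x)%:R.

Lemma costE mu : cost mu = \sum_v \sum_(x in mu v) w x.
Proof.
rewrite (exchange_big_dep xpredT)//=; apply: eq_bigr => x _.
rewrite /mult -sum1_card natr_sum mulr_sumr.
by apply: eq_big => [v|v _]; rewrite ?inE ?mulr1.
Qed.

Variable s : R.
Hypothesis cost_ge : forall mu, jumbled_model mu -> s <= cost mu.
Hypothesis w_ge0 : forall x, 0 <= w x.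

(** Every image contains [x], and an edge of [H] has an end in the cover, whose image also contains
    [y]; the edge [xy] then joins the two images. *)
Lemma cost_edge x y : adj x y -> s <= #|H|%:R * w x + (tau H)%:R * w y.
Proof.
move=> xy; rewrite /tau; case: arg_minnP => [|T Tcov _].
  by apply/forallP => a; apply/forallP => b; rewrite !finset.in_setT implybT.
pose mu : {ffun H -> {set G}} :=
  [ffun v => if v \in T then [set x; y]%SET else [set x]%SET].
have mumod : jumbled_model mu.
  apply/andP; split; apply/forallP => a.
    by rewrite ffunE; case: ifP => _; [exact: connected_edge|exact: connected_set1].
  apply/forallP => b; apply/implyP => ab; rewrite !ffunE.
  have := forallP (forallP Tcov a) b; rewrite ab /=.
  case: (a \in T) => [_|/= ->].
    by apply: (@touchingP _ _ _ y x); rewrite ?set22 1?adj_sym//; case: ifP;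
      rewrite ?set11 ?set21.
  by apply: (@touchingP _ _ _ x y); rewrite ?set11 ?set22.
apply: le_trans (cost_ge mumod) _; rewrite costE.
rewrite (eq_bigr (fun v => w x + (v \in T)%:R * w y)); last first.
  move=> v _; rewrite ffunE; case: ifP => _.
    rewrite big_setU1 ?big_set1 ?mul1r// inE.
    by apply: contraTneq xy => ->; rewrite adj_irrefl.
  by rewrite big_set1 mul0r addr0.
rewrite (_ : #|T| = \sum_v (v \in T))%N; last by rewrite -sum1_card big_mkcond.
by rewrite big_split/= sumr_const mulr_natl -mulr_suml -natr_sum.
Qed.

(* Averaging over the four cyclic shifts of the colours. *)
Lemma cost_colored (f : {ffun H -> 'I_4}) (S : 4.-tuple {set G}) :
  proper_coloring f ->
  (forall A, A \in S -> connected_graph (induced_subgraph A)) ->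
  pairwise (@touching G) S ->
  4 * s <= #|H|%:R * \sum_(A <- S) \sum_(x in A) w x.
Proof.
(* Addition in ['I_4] is modulo 4, so a shift keeps distinct colours distinct. *)
move=> fcol Scon Stouch; pose mu j := [ffun v : H => tnth S (f v + j)].
have touchS i j : i != j -> touching (tnth S i) (tnth S j).
  wlog ij : i j / (i < j)%N => [hw ij|_].
    have := ij; rewrite -(inj_eq val_inj) neq_ltn => /orP[]ij'; first exact: hw.
    by rewrite touching_sym; apply: hw => //; rewrite eq_sym.
  rewrite !(tnth_nth finset.set0); apply: (pairwiseP finset.set0 Stouch) => //;
    by rewrite inE size_tuple.
have mumod j : jumbled_model (mu j).
  apply/andP; split; apply/forallP => a.
    by rewrite ffunE; apply: Scon; apply: mem_tnth.
  apply/forallP => b; apply/implyP => ab; rewrite !ffunE; apply: touchS.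
  rewrite (inj_eq (addIr j)).
  by have := forallP (forallP fcol a) b; rewrite ab.
have -> : 4 * s = \sum_(j < 4) s by rewrite sumr_const card_ord mulr_natl.
apply: (@le_trans _ _ (\sum_(j < 4) cost (mu j))).
  by apply: ler_sum => j _; apply: cost_ge.
under eq_bigr do rewrite costE; rewrite exchange_big /=.
(* For fixed [v] the colour [f v + j] takes all four values, so [v] pays for each set of [S]
   once. *)
rewrite mulr_natl -sumr_const; apply: ler_sum => v _.
rewrite big_tuple [leRHS](reindex_inj (addrI (f v))) /=.
by apply: ler_sum => j _; rewrite ffunE.
Qed.

(** The set [{x, y}] plays a fourth clique vertex: it touches [{x}] and [{y}] through the edge [xy]
    itself, and the overlap doubles the weights of [x] and [y]. *)
Lemma cost_triangle (f : {ffun H -> 'I_4}) x y z : proper_coloring f ->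
  adj x y -> adj x z -> adj y z ->
  4 * s <= #|H|%:R * (2 * w x + 2 * w y + w z).
Proof.
move=> fcol xy xz yz.
have := @cost_colored f [tuple [set x]; [set y]; [set z]; [set x; y]]%SET fcol.
rewrite !big_cons big_nil !big_set1 big_setU1 ?big_set1; last first.
  by rewrite inE; apply: contraTneq xy => ->; rewrite adj_irrefl.
rewrite /= (_ : w x + _ = 2 * w x + 2 * w y + w z); last by ring.
apply.
  by move=> A; rewrite !inE => /or4P[]/eqP->;
    [exact: connected_set1|exact: connected_set1|exact: connected_set1
    |exact: connected_edge].
have yx := xy; rewrite adj_sym in yx; have zx := xz; rewrite adj_sym in zx.
rewrite /= !andbT; do !(apply/andP; split);
 by [apply: (@touchingP _ _ _ x y); rewrite ?set11 ?set21 ?set22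
    |apply: (@touchingP _ _ _ x z); rewrite ?set11 ?set21 ?set22
    |apply: (@touchingP _ _ _ y z); rewrite ?set11 ?set21 ?set22
    |apply: (@touchingP _ _ _ y x); rewrite ?set11 ?set21 ?set22
    |apply: (@touchingP _ _ _ z x); rewrite ?set11 ?set21 ?set22].
Qed.

Lemma cost_K4 (f : {ffun H -> 'I_4}) x y z t : proper_coloring f ->
  adj x y -> adj x z -> adj x t -> adj y z -> adj y t -> adj z t ->
  4 * s <= #|H|%:R * (w x + w y + w z + w t).
Proof.
move=> fcol xy xz xt yz yt zt.
have := @cost_colored f [tuple [set x]; [set y]; [set z]; [set t]]%SET fcol.
rewrite !big_cons big_nil !big_set1 addr0 !addrA; apply.
  by move=> A; rewrite !inE => /or4P[]/eqP->; exact: connected_set1.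
have touch1 a b : adj a b -> touching [set a]%SET [set b]%SET.
  by apply: touchingP; rewrite set11.
by rewrite /= !touch1.
Qed.

(** After rescaling the weights by [c / s], the bounds [#|H| <= 2 * c] and [tau H <= c] turn the
    three cost estimates into the hypotheses of [edges_le_weight]. *)
Lemma edges_le_cost (f : {ffun H -> 'I_4}) (c : R) : proper_coloring f ->
  #|H|%:R <= 2 * c -> (tau H)%:R <= c -> 0 < s ->
  s * #|edges G|%:R <= c * #|G|%:R * \sum_x w x.
Proof.
move=> fcol Hc tauc s0; pose u x := c * w x / s.
have c0 : 0 <= c by apply: le_trans tauc.
have Hw W : 0 <= W -> #|H|%:R * W <= 2 * c * W by move=> W0; apply: ler_wpM2r.
have : #|edges G|%:R <= #|G|%:R * \sum_x u x; last first.
  rewrite -mulr_suml -mulr_sumr mulrA ler_pdivlMr//.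
  by congr (_ <= _); ring.
apply: edges_le_weight => [x|x y xy _|x y z xy xz yz|x y z t xy xz xt yz yt zt].
- by rewrite divr_ge0 ?mulr_ge0// ltW.
- rewrite -(ler_pM2r s0) mulrDl mulrA !divfK ?gt_eqF// mul1r.
  have := cost_edge xy; have := Hw _ (w_ge0 x).
  have : (tau H)%:R * w y <= c * w y by apply: ler_wpM2r.
  lra.
- rewrite -(ler_pM2r s0) !mulrDl -!mulrA !mulVf ?gt_eqF// !mulr1.
  have := cost_triangle fcol xy xz yz; have := Hw (2 * w x + 2 * w y + w z).
  by have := w_ge0 x; have := w_ge0 y; have := w_ge0 z; lra.
- rewrite -(ler_pM2r s0) !mulrDl -!mulrA !mulVf ?gt_eqF// !mulr1.
  have := cost_K4 fcol xy xz xt yz yt zt; have := Hw (w x + w y + w z + w t).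
  by have := w_ge0 x; have := w_ge0 y; have := w_ge0 z; have := w_ge0 t; lra.
Qed.

End Models.

(** * Bounds on the volume *)

Lemma colorable_le (H : sgraph) k : (chi H <= k)%N ->
  exists f : {ffun H -> 'I_k}, proper_coloring f.
Proof.
rewrite /chi; case: ex_minnP => m /existsP[f fcol] _ mk.
exists [ffun v => widen_ord mk (f v)].
apply/forallP => a; apply/forallP => b; rewrite !ffunE.
by have := forallP (forallP fcol a) b; rewrite -!(inj_eq val_inj).
Qed.

Lemma edges_adj (G : sgraph) : (0 < #|edges G|)%N -> exists x y : G, adj x y.
Proof.
by case/card_gt0P=> e /imsetP[[x y]]; rewrite inE /= => xy _; exists x, y.
Qed.

Lemma Vol_ge0 (R : realType) (H G : sgraph) : (0 <= Vol R H G)%E.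
Proof.
apply: ereal_sup_ubound; exists 0%N, (fun=> 0).
exists (fun=> [ffun=> finset.set0]); split; last by rewrite big_ord0.
by split=> [[]|[]|x] //; rewrite big_ord0 ler01.
Qed.

(** Weak duality: sum the packing constraints with coefficients [w x]. *)
Lemma Vol_le (R : realType) (H G : sgraph) (w : G -> R) k :
  (forall x, 0 <= w x) -> 0 < k ->
  (forall mu : {ffun H -> {set G}}, jumbled_model mu -> k <= cost w mu) ->
  (Vol R H G <= ((\sum_x w x) / k)%:E)%E.
Proof.
move=> w0 k0 kcost; apply: ge_ereal_sup => _ [n [al [mu [[al0 mumod pack] ->]]]].
rewrite lee_fin ler_pdivlMr// mulr_suml.
apply: (@le_trans _ _ (\sum_i al i * cost w (mu i))).
  by apply: ler_sum => i _; rewrite ler_wpM2l// kcost.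
rewrite (eq_bigr (fun i => \sum_x w x * (al i * (mult (mu i) x)%:R))); last first.
  by move=> i _; rewrite mulr_sumr; apply: eq_bigr => x _; rewrite mulrCA.
rewrite exchange_big; apply: ler_sum => x _.
by rewrite -mulr_sumr ler_piMr.
Qed.

(** By [minimax], either a distribution on models loads each vertex by at most [t], and dividing it
    by [t] gives a packing of value [t^-1], or some [w] makes every model cost more than [t] times
    its total, against [edges_le_cost]. *)
Lemma Vol_ge (R : realType) (H G : sgraph) (c t : R) : (chi H <= 4)%N ->
  #|H|%:R <= 2 * c -> (tau H)%:R <= c -> (0 < #|edges G|)%N ->
  0 < t -> c * #|G|%:R < t * #|edges G|%:R ->
  (t^-1%:E <= Vol R H G)%E.
Proof.
move=> /colorable_le[f fcol] Hc tauc e0 t0 ct.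
pose J := {mu : {ffun H -> {set G}} | jumbled_model mu}.
have [[al [al0 al1 alt]]|[w w0 wJ]] :=
    @minimax R G J (fun mu x => (mult (val mu) x)%:R) t.
  apply: ereal_sup_ubound; exists #|{: J}|, (fun i => al (enum_val i) / t).
  exists (fun i => val (enum_val i)); split; last first.
    rewrite -mulr_suml -(big_enum_val al) /= (eq_bigl xpredT)// al1 div1r//.
  split=> [i|i|x]; first by rewrite divr_ge0// ltW.
  - exact: (valP (enum_val i)).
  - rewrite (eq_bigr (fun i => al (enum_val i) * (mult (val (enum_val i)) x)%:R / t)).
      rewrite -mulr_suml -(big_enum_val (fun j => al j * (mult (val j) x)%:R)) /=.
      by rewrite ler_pdivrMr// mul1r.
    by move=> i _; rewrite mulrAC.
have [x0 [y0 xy0]] := edges_adj e0.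
have wcost (mu : {ffun H -> {set G}}) : jumbled_model mu -> t * \sum_x w x < cost w mu.
  by move=> mumod; apply: (wJ (exist _ mu mumod)).
have W0 : 0 <= \sum_x w x by apply: sumr_ge0.
(* [edges_le_cost] needs a positive cost bound. If [w] vanished, the constant model on an edge would
   cost 0, yet more than [t * 0]. *)
have [W|W] := eqVneq (\sum_x w x) 0.
  have w00 x : w x = 0.
    apply/eqP; move/eqP: W; rewrite psumr_eq0// => /allP/(_ x).
    by rewrite mem_index_enum => /(_ isT).
  pose mu : {ffun H -> {set G}} := [ffun=> [set x0; y0]%SET].
  have /wcost : jumbled_model mu.
    apply/andP; split; apply/forallP => a; first by rewrite ffunE; apply: connected_edge.
    apply/forallP => b; apply/implyP => _; rewrite !ffunE.
    by apply: (@touchingP _ _ _ x0 y0); rewrite ?set21 ?set22.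
  rewrite W mulr0 /cost big1 ?ltxx// => x _.
  by rewrite w00 mul0r.
have {W0}W : 0 < \sum_x w x by rewrite lt_neqAle eq_sym W.
have := @edges_le_cost R H G w (t * \sum_x w x) (fun mu h => ltW (wcost mu h)) w0
  f c fcol Hc tauc.
by rewrite mulr_gt0// mulrAC ler_pM2r// leNgt ct => /(_ isT).
Qed.

(** Inversion is antitone on all of [[0, +oo]], so volumes [0] and [+oo] need no separate case. *)
Lemma density_div_Vol_ge (R : realType) (H G : sgraph) (B : R) : 0 < B ->
  (Vol R H G <= B%:E)%E -> ((density R G / B)%:E <= (density R G)%:E / Vol R H G)%E.
Proof.
move=> B0 VB; rewrite [leLHS]EFinM.
apply: lee_wpmul2l.
  by rewrite lee_fin divr_ge0.
rewrite inve_pge ?inE ?lee_fin ?invr_ge0 ?(ltW B0) ?Vol_ge0//.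
by rewrite inver gt_eqF ?invr_gt0// invrK.
Qed.

Lemma density_div_Vol_le (R : realType) (H G : sgraph) (B : R) : 0 < B ->
  (B^-1%:E <= Vol R H G)%E -> ((density R G)%:E / Vol R H G <= (density R G * B)%:E)%E.
Proof.
move=> B0 VB; rewrite [leRHS]EFinM.
apply: lee_wpmul2l.
  by rewrite lee_fin divr_ge0.
by rewrite inve_ple ?inE ?lee_fin ?(ltW B0) ?Vol_ge0// inver gt_eqF.
Qed.

(** A dual weighting of a single graph certifies a lower bound, through [Vol_le]. *)
Lemma c_f_ge_ratio (R : realType) (H G : sgraph) (w : G -> R) k :
  (0 < #|G|)%N -> (forall x, 0 <= w x) -> 0 < \sum_x w x -> 0 < k ->
  (forall mu : {ffun H -> {set G}}, jumbled_model mu -> k <= cost w mu) ->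
  ((density R G * k / \sum_x w x)%:E <= c_f R H)%E.
Proof.
move=> G0 w0 W0 k0 kcost.
apply: le_trans (ereal_sup_ubound _); last by exists G.
rewrite -mulrA -[k / _]invf_div; apply: density_div_Vol_ge; first exact: divr_gt0.
exact: Vol_le.
Qed.

Lemma c_f_ge0 (R : realType) (H G : sgraph) : (0 < #|G|)%N -> (0 <= c_f R H)%E.
Proof.
move=> G0; apply: le_trans (ereal_sup_ubound _); last by exists G.
by rewrite mule_ge0 ?inve_ge0 ?Vol_ge0// lee_fin divr_ge0.
Qed.

(** * Complete graphs and stars *)

Lemma complete_sym m : symmetric (fun i j : 'I_m => i != j).
Proof. by move=> i j; rewrite eq_sym. Qed.

Lemma complete_irrefl m : irreflexive (fun i j : 'I_m => i != j).
Proof. by move=> i; rewrite eqxx. Qed.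

Definition complete m := SGraph (@complete_sym m) (@complete_irrefl m).

Lemma density_complete (R : realType) m :
  density R (complete m.+1) = m%:R / 2.
Proof.
have E : (2 * #|edges (complete m.+1)| = m.+1 * m)%N.
  transitivity (\sum_(i < m.+1) m)%N; last by rewrite sum_nat_const card_ord.
  rewrite -edges_double; apply: eq_bigr => i _.
  have Ci : #|predC1 (i : 'I_m.+1)| = m by rewrite cardC1 card_ord.
  rewrite -[RHS]Ci -sum1_card [RHS]big_mkcond /=.
  by apply: eq_bigr => j _; rewrite !inE eq_sym; case: eqP.
rewrite /density card_ord; apply/eqP; rewrite eqr_div ?pnatr_eq0//.
by rewrite -!natrM eqr_nat mulnC E mulnC.
Qed.

(** The centre is [ord0], with [t] leaves; exclusive or makes symmetry and irreflexivity
    immediate. *)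
Definition star_adj t (x y : 'I_t.+1) := (x == ord0) (+) (y == ord0).

Lemma star_sym t : symmetric (@star_adj t).
Proof. by move=> i j; rewrite /star_adj addbC. Qed.

Lemma star_irrefl t : irreflexive (@star_adj t).
Proof. by move=> i; rewrite /star_adj addbb. Qed.

Definition star t := SGraph (@star_sym t) (@star_irrefl t).

Lemma density_star (R : realType) t :
  density R (star t) = t%:R / t.+1%:R.
Proof.
have S1 (F : star t -> nat) :
    (\sum_x F x = F ord0 + \sum_(i < t) F (lift ord0 i))%N.
  exact: (@big_ord_recl _ _ _ t F).
have E : (2 * #|edges (star t)| = 2 * t)%N.
  rewrite -edges_double S1 S1 adj_irrefl.
  rewrite [X in (_ + X)%N](eq_bigr (fun=> 1%N)); last by move=> i _; rewrite S1 big1.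
  rewrite [X in (_ + X + _)%N](eq_bigr (fun=> 1%N)) //.
  by rewrite !sum1_card card_ord mul2n -addnn.
move/eqP: E; rewrite eqn_pmul2l// => /eqP E.
by rewrite /density E card_ord.
Qed.

(** Connected images are nonempty, so each vertex of [H] pays at least 1. *)
Lemma cost_complete (R : realType) (H G : sgraph) (mu : {ffun H -> {set G}}) :
  jumbled_model mu -> #|H|%:R <= cost (fun=> 1 : R) mu.
Proof.
case/andP=> /forallP con _; rewrite costE -sum1_card natr_sum.
apply: ler_sum => v _; rewrite sumr_const ler1n.
have /andP[/card_gt0P[[x xv] _] _] := con v.
by apply/card_gt0P; exists x.
Qed.

Lemma cost_star (R : realType) (H : sgraph) t (mu : {ffun H -> {set star t}}) :
  jumbled_model mu -> (tau H)%:R <= cost (fun x : star t => (x == ord0)%:R : R) mu.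
Proof.
case/andP=> _ /forallP touch; rewrite /cost (bigD1 ord0)//= big1 ?addr0; last first.
  by move=> x /negbTE->; rewrite mul0r.
rewrite mul1r ler_nat /tau /mult; case: arg_minnP => [|T _ minT].
  by apply/forallP => a; apply/forallP => b; rewrite !finset.in_setT implybT.
apply: minT; apply/forallP => a; apply/forallP => b; apply/implyP => ab.
have /existsP[x /andP[xa /existsP[y /andP[yb]]]] := implyP (forallP (touch a) b) ab.
rewrite !inE /= /star_adj.
by case: eqP xa => [-> ->|_ _]; case: eqP yb => [-> ->|_ _] //; rewrite orbT.
Qed.

(** Complete graphs and stars certify their bounds only up to a factor [k / k.+1], which tends to
    1. *)
Lemma lee_limit_ratio (R : realType) (a : R) (y : \bar R) : 0 <= a ->
  (forall k, (a * (k%:R / k.+1%:R))%:E <= y)%E -> (a%:E <= y)%E.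
Proof.
move=> a0 ay; apply/lee_addgt0Pr => e e0.
pose k := Num.truncn (a / e).
apply: (@le_trans _ _ ((a * (k%:R / k.+1%:R))%:E + e%:E)%E); last exact: leeD2r.
have ke : a < k.+1%:R * e by rewrite -ltr_pdivrMr// truncnS_gt.
rewrite lee_fin (_ : k%:R / k.+1%:R = 1 - k.+1%:R^-1); last first.
  by rewrite -natr1; field; rewrite natr1 pnatr_eq0.
rewrite mulrBr mulr1 -addrA lerDl addrC subr_ge0 ler_pdivrMr ?ltr0n//.
by rewrite mulrC ltW.
Qed.

Theorem theorem2p2 (R : realType) (H : sgraph) (chiH : (chi H <= 4)%N) :
  c_f R H = (Num.max (#|H|%:R / 2%:R) (tau H)%:R)%R%:E.
Proof.
set c := Num.max _ _.
have Hc : #|H|%:R <= 2 * c by rewrite mulrC -ler_pdivrMr// le_max lexx.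
have tauc : (tau H)%:R <= c by rewrite le_max lexx orbT.
have c0 : 0 <= c by apply: le_trans tauc.
apply/eqP; rewrite eq_le; apply/andP; split.
  apply: ge_ereal_sup => _ [G G0 ->].
  (* Without edges the density is 0, hence so is the quotient, whatever the volume. *)
  have [e0|] := posnP #|edges G|; first by rewrite /density e0 mul0r mul0e lee_fin.
  (* The slack [e] provides the strict inequality that [Vol_ge] requires, with
     [t = (c + e) / density R G]. *)
  move=> e0; apply/lee_addgt0Pr => e ep.
  have d0 : 0 < density R G by rewrite divr_gt0 ?ltr0n.
  have B0 : 0 < (c + e) / density R G by rewrite divr_gt0// ltr_wpDl.
  apply: le_trans (density_div_Vol_le B0 _) _.
    apply: (Vol_ge chiH Hc tauc e0 B0).
    rewrite /density invf_div mulrA divfK ?gt_eqF ?ltr0n//.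
    by rewrite ltr_pM2r ?ltr0n// ltrDl.
  by rewrite mulrC divfK ?gt_eqF// EFinD.
rewrite /c EFin_max ge_max; apply/andP; split.
  have [H0|H0] := posnP #|H|.
    by rewrite H0 mul0r; apply: (@c_f_ge0 _ _ (complete 1)); rewrite card_ord.
  apply: lee_limit_ratio => [|k]; first by rewrite divr_ge0.
  have := @c_f_ge_ratio R H (complete k.+1) (fun=> 1) #|H|%:R.
  rewrite sumr_const card_ord density_complete ltr0n /=.
  rewrite (_ : k%:R / 2 * _ / _ = #|H|%:R / 2 * (k%:R / k.+1%:R)); last first.
    by field; rewrite ?nat1r ?natr1 pnatr_eq0.
  apply=> //; first by rewrite ltr0n.
  by move=> mu; apply: (@cost_complete R H (complete k.+1)).
have [t0|t0] := posnP (tau H).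
  by rewrite t0; apply: (@c_f_ge0 _ _ (complete 1)); rewrite card_ord.
apply: lee_limit_ratio => // k.
(* All weight sits on the centre, so its total is 1 and the ratio is the density times [tau H]. *)
have := @c_f_ge_ratio R H (star k) (fun x : star k => (x == ord0)%:R) (tau H)%:R.
rewrite (bigD1 ord0)//= big1 ?addr0; last by move=> x /negbTE->.
rewrite density_star divr1 mulrC; apply=> //.
- by rewrite card_ord.
- by rewrite ltr0n.
- exact: cost_star.
Qed.
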